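(* Let $A$ be a compactly generated locally compact abelian group and let $M$ be an LC $A$-module. Then the polycompact radical $\mathrm{W}(M)$ is a closed subgroup of $M$, and every compact subset of $\mathrm{W}(M)$ is contained in a compact submodule of $M$.
   Context: All topological groups are Hausdorff. For a locally compact abelian (LCA) group $A$, an LC $A$-module is an LCA group $M$ together with a continuous action $A\times M\to M$ of $A$ by topological group automorphisms; submodules are $A$-invariant subgroups. The polycompact radical $\mathrm{W}(M)$ is the sum (union, i.e. the subgroup generated) of all compact submodules of $M$. *)

(* Defs.v *)
From HB Require Import structures.
From mathcomp Require Import all_boot all_order all_algebra.
From mathcomp Require Import all_classical all_reals all_analysis.
Set Implicit Arguments. Unset Strict Implicit. Unset Printing Implicit Defensive.
Import Order.TTheory GRing.Theory Num.Theory.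
Local Open Scope classical_set_scope.
Local Open Scope ring_scope.

Definition is_subgroup (G : zmodType) (S : set G) : Prop :=
  S 0 /\ (forall x y, S x -> S y -> S (x - y)).

Definition gen_subgroup (G : zmodType) (X : set G) : set G :=
  fun g => forall H : set G, is_subgroup H -> X `<=` H -> H g.

Definition LCA (G : topologicalZmodType) : Prop :=
  hausdorff_space G /\ locally_compact [set: G].

Definition compactly_generated (G : topologicalZmodType) : Prop :=
  exists K : set G, compact K /\ gen_subgroup K = [set: G].

Definition LC_action (A M : topologicalZmodType) (act : A -> M -> M) : Prop :=
  continuous (fun p : A * M => act p.1 p.2) /\
  (forall m, act 0 m = m) /\
  (forall a b m, act (a + b) m = act a (act b m)) /\
  (forall a m n, act a (m + n) = act a m + act a n).

Definition is_submodule (A M : topologicalZmodType) (act : A -> M -> M)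
    (S : set M) : Prop :=
  is_subgroup S /\ (forall a m, S m -> S (act a m)).

Definition compact_submodule (A M : topologicalZmodType) (act : A -> M -> M)
    (S : set M) : Prop :=
  is_submodule act S /\ compact S.

Definition polycompact_radical (A M : topologicalZmodType) (act : A -> M -> M)
    : set M :=
  gen_subgroup (\bigcup_(S in compact_submodule act) S).

(* Main.v *)
Require Import Defs.
From HB Require Import structures.
From mathcomp Require Import all_boot all_order all_algebra.
From mathcomp Require Import all_classical all_reals all_analysis.
Set Implicit Arguments. Unset Strict Implicit. Unset Printing Implicit Defensive.
Import GRing.Theory.
Local Open Scope classical_set_scope.
Local Open Scope ring_scope.

(** Let [W] be the union of the compact submodules, [B] its closure, [V] the
    trace on [B] of a compact neighborhood of [0], [K] a compact generating set
    of [A], and [L] a compact subset of [B]. The set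
    [T = L `|` (V - V) `|` K V `|` (- K) V] is compact and contained in [B], in
    which [W] is dense; as the compact submodules are directed, a single one of
    them, [C], satisfies [T `<=` V + C]. Then [V + C] is a compact submodule
    that contains [L]. For [L = [set x]] with [x] in [B] this gives [B = W]. *)

Section Subgroup.
Variables (G : zmodType) (S : set G).
Hypothesis subS : is_subgroup S.

Lemma is_subgroupN x : S x -> S (- x).
Proof. by move=> Sx; rewrite -sub0r; apply: subS.2 => //; exact: subS.1. Qed.

Lemma is_subgroupD x y : S x -> S y -> S (x + y).
Proof. by move=> Sx Sy; rewrite -[y]opprK; apply/subS.2/is_subgroupN. Qed.

End Subgroup.

Lemma gen_subgroup_is_subgroup (G : zmodType) (X : set G) :
  is_subgroup (gen_subgroup X).
Proof.
split=> [H [] //|x y Xx Xy H HG XH].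
by apply: HG.2; [exact: Xx|exact: Xy].
Qed.

Definition sumset (G : zmodType) (X Y : set G) : set G :=
  [set x.1 + x.2 | x in X `*` Y].

Lemma compact_sumset (M : topologicalZmodType) (X Y : set M) :
  compact X -> compact Y -> compact (sumset X Y).
Proof.
move=> cX cY; apply: continuous_compact; last exact: compact_setX.
exact/continuous_subspaceT/add_continuous.
Qed.

Lemma sumset_is_subgroup (G : zmodType) (X Y : set G) :
  is_subgroup X -> is_subgroup Y -> is_subgroup (sumset X Y).
Proof.
move=> gX gY; split.
  by exists (0, 0); rewrite ?addr0//; split; [exact: gX.1|exact: gY.1].
move=> _ _ [[a b] [/= Xa Yb] <-] [[c d] [/= Xc Yd] <-].
exists (a - c, b - d) => /=; last by rewrite opprD addrACA.
by split; [exact: gX.2|exact: gY.2].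
Qed.

Section Module.
Variables (A M : topologicalZmodType) (act : A -> M -> M).
Hypothesis actP : LC_action act.

Let act_continuous : continuous (fun p : A * M => act p.1 p.2) := actP.1.
Let act0l : forall m, act 0 m = m := actP.2.1.
Let actDl : forall a b m, act (a + b) m = act a (act b m) := actP.2.2.1.
Let actDr : forall a m n, act a (m + n) = act a m + act a n := actP.2.2.2.

Lemma compact_act (K : set A) (X : set M) : compact K -> compact X ->
  compact [set act p.1 p.2 | p in K `*` X].
Proof.
move=> cK cX; apply: continuous_compact; last exact: compact_setX.
exact/continuous_subspaceT/act_continuous.
Qed.

(** The elements [b] such that both [b] and [- b] map [N] into itself form a subgroup [H] of [A]. It
    contains [K], hence is all of [A]. Asking for both signs is what makes [H] closed under
    subtraction. *)
Lemma stable_generated (K : set A) (N : set M) : gen_subgroup K = [set: A] ->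
  (forall k m, K k -> N m -> N (act k m) /\ N (act (- k) m)) ->
  forall a m, N m -> N (act a m).
Proof.
move=> genK NK a m Nm.
pose H : set A := [set b | forall m, N m -> N (act b m) /\ N (act (- b) m)].
suff /(_ _ Nm)[] : H a by [].
have : gen_subgroup K a by rewrite genK.
apply=> [|k Kk n Nn]; last exact: NK.
split=> [n Nn|b c Hb Hc n Nn]; first by rewrite oppr0 act0l.
split; first by rewrite actDl; apply: (Hb _ _).1; apply: (Hc _ _).2.
by rewrite opprB actDl; apply: (Hc _ _).1; apply: (Hb _ _).2.
Qed.

Lemma closure_is_submodule (S : set M) :
  is_submodule act S -> is_submodule act (closure S).
Proof.
move=> [gS aS]; split; first split.
- by apply: subset_closure; exact: gS.1.
- move=> x y Sx Sy U /(@sub_continuous M (x, y))[[P Q] [/= xP yQ] PQU].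
  have [[p [Sp Pp]] [q [Sq Qq]]] := (Sx _ xP, Sy _ yQ).
  by exists (p - q); split; [exact: gS.2|exact: (PQU (p, q))].
- move=> a x Sx U /(act_continuous (x := (a, x)))[[P Q] [/= aP xQ] PQU].
  have [q [Sq Qq]] := Sx _ xQ; exists (act a q); split; first exact: aS.
  by apply: (PQU (a, q)); split => //; exact: nbhs_singleton aP.
Qed.

Lemma sumset_compact_submodule (S T : set M) :
  compact_submodule act S -> compact_submodule act T ->
  compact_submodule act (sumset S T).
Proof.
move=> [[gS aS] cS] [[gT aT] cT]; split; last exact: compact_sumset.
split; first exact: sumset_is_subgroup.
move=> a _ [[s t] [/= Ss Tt] <-]; exists (act a s, act a t) => //=.
by split; [exact: aS|exact: aT].
Qed.

Lemma compact_submodule0 : compact_submodule act [set 0].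
Proof.
split; last exact: compact_set1.
split; first by split=> // x y -> ->; rewrite subr0.
(* [act a 0] is idempotent for addition, hence zero by cancellation. *)
by move=> a m ->; apply: (addrI (act a 0)); rewrite -actDr !addr0.
Qed.

Lemma compact_submodule_directed (S T : set M) :
  compact_submodule act S -> compact_submodule act T ->
  exists2 U, compact_submodule act U & S `<=` U /\ T `<=` U.
Proof.
move=> mS mT; exists (sumset S T); first exact: sumset_compact_submodule.
split=> x Xx; [exists (x, 0)|exists (0, x)]; rewrite /= ?addr0 ?add0r//.
- by split=> //; exact: mT.1.1.1.
- by split=> //; exact: mS.1.1.1.
Qed.

Local Notation W := (polycompact_radical act).

(** Two compact submodules lie in a common one, so their union is already closed under
    subtraction. *)
Lemma polycompact_radicalE :
  W = \bigcup_(S in compact_submodule act) S.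
Proof.
apply/seteqP; split=> [x|x Sx H _]; last exact.
apply=> //; split; first by exists [set 0] => //; exact: compact_submodule0.
move=> y z [S mS Sy] [T mT Tz].
have [U mU [SU TU]] := compact_submodule_directed mS mT.
by exists U => //; apply: mU.1.1.2; [exact: SU|exact: TU].
Qed.

Lemma polycompact_radical_submodule : is_submodule act W.
Proof.
split; first exact: gen_subgroup_is_subgroup.
move=> a m; rewrite polycompact_radicalE => -[S mS Sm].
by exists S => //; exact: mS.1.2.
Qed.

(** Near each point of [T] one compact submodule suffices, by density of [W] in its closure.
    Compactness leaves finitely many of them, and directedness puts these into a single [C]. *)
Lemma compact_sub_nbhs0_sumset (V T : set M) : nbhs 0 V -> compact T ->
  T `<=` closure W ->
  exists2 C, compact_submodule act C & T `<=` sumset V C.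
Proof.
move=> V0 cT TW.
(* The filter of tails of the directed family: a property holds near [F] when all compact submodules
   containing some fixed one have it. *)
pose F := filter_from (compact_submodule act)
  (fun C => [set D | compact_submodule act D /\ C `<=` D]).
have FF : Filter F.
  apply: filter_from_filter; first by exists [set 0]; exact: compact_submodule0.
  move=> S S' mS mS'; have [U mU [SU S'U]] := compact_submodule_directed mS mS'.
  by exists U => // D [mD UD]; split; split=> //; exact: subset_trans UD.
have /compact_near_coveringP/(_ _ F (fun C y => sumset V C y) FF) := cT.
case=> [x Tx|C mC CT]; last by exists C => //; apply: CT; split.
have [[P Q] [/= xP xQ] PQV] : nbhs (x, x) [set p : M * M | V (p.1 - p.2)].
  by apply: (@sub_continuous M (x, x)); rewrite /= subrr.
(* A single [w] of [W] close to [x] serves every [y] in [P]: write [y = (y - w) + w] with [y - w] in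
   [V]. *)
have [w [Ww Qw]] := TW _ Tx _ xQ.
move: Ww; rewrite polycompact_radicalE => -[S mS Sw].
exists (P, [set D | compact_submodule act D /\ S `<=` D]).
  by split=> //; exists S.
move=> [y D] [/= Py [mD SD]]; exists (y - w, w); rewrite /= ?subrK//.
by split; [exact: (PQV (y, w))|exact: SD].
Qed.

Lemma compact_sub_compact_submodule (L : set M) :
  compactly_generated A -> locally_compact [set: M] ->
  compact L -> L `<=` closure W ->
  exists S, compact_submodule act S /\ L `<=` S.
Proof.
move=> [K [cK genK]] lcM cL LW.
have [gB aB] := closure_is_submodule polycompact_radical_submodule.
have [U U0 cU] : exists2 U : set M, nbhs 0 U & compact U.
  by have := lcM 0 I; rewrite withinET => -[U U0 [cU _]]; exists U.
pose V := U `&` closure W.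
have cV : compact V by apply: compact_closedI => //; exact: closed_closure.
(* Besides [L], these are the differences of elements of [V] and their images under generators and
   inverse generators: all that [V + C] must absorb to be a submodule. *)
pose T := L `|` [set x.1 - x.2 | x in V `*` V] `|`
  ([set act p.1 p.2 | p in K `*` V] `|`
   [set act p.1 p.2 | p in [set - k | k in K] `*` V]).
have cT : compact T.
  apply: compactU; apply: compactU => //.
  - apply: continuous_compact; last exact: compact_setX.
    exact/continuous_subspaceT/sub_continuous.
  - exact: compact_act.
  - apply: compact_act => //; apply: continuous_compact => //.
    exact/continuous_subspaceT/opp_continuous.
have TW : T `<=` closure W.
  move=> t [[/LW//|[[x y] [/= [_ ?] [_ ?]] <-]]|[|]]; first exact: gB.2.
  - by move=> [[k x] [/= _ [_ ?]] <-]; exact: aB.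
  - by move=> [[k x] [/= _ [_ ?]] <-]; exact: aB.
have [C mC TUC] := compact_sub_nbhs0_sumset U0 cT TW.
have [[gC aC] cC] := mC.
have CW : C `<=` closure W.
  by move=> x Cx; apply: subset_closure; rewrite polycompact_radicalE; exists C.
have TVC : T `<=` sumset V C.
  (* The component [u = t - c] is a difference of elements of [closure W], so it lies in [V] and not
     only in [U]. *)
  move=> t Tt; have [[u c] [/= Uu Cc] ucE] := TUC _ Tt; exists (u, c) => //.
  split=> //; split=> //; rewrite -[u](addrK c) ucE.
  by apply: gB.2; [exact: TW|exact: CW].
(* Since [V + C] is stable under adding [C], the submodule conditions need checking only on [V],
   where they follow from [TVC]. *)
have VCD x c : sumset V C x -> C c -> sumset V C (x + c).
  move=> [[v d] [/= Vv Cd] <-] Cc; exists (v, d + c); rewrite /= ?addrA//.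
  by split=> //; exact: is_subgroupD.
exists (sumset V C); split; last by move=> x Lx; apply: TVC; do 2 left.
split; last exact: compact_sumset.
split; first split.
- exists (0, 0); rewrite /= ?addr0//; split; last exact: gC.1.
  by split; [exact: nbhs_singleton|exact: gB.1].
- move=> _ _ [[v c] [/= Vv Cc] <-] [[w d] [/= Vw Cd] <-].
  rewrite opprD addrACA; apply: VCD; last exact: gC.2.
  by apply: TVC; left; right; exists (v, w).
- apply: (stable_generated genK) => k _ Kk [[v c] [/= Vv Cc] <-].
  rewrite !actDr; split; apply: VCD; try exact: aC; apply: TVC; right.
    by left; exists (k, v).
  by right; exists (- k, v) => //; split=> //; exists k.
Qed.

End Module.

Theorem mainTheorem1 (A M : topologicalZmodType) (act : A -> M -> M) :
  LCA A -> compactly_generated A -> LCA M -> LC_action act ->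
  is_subgroup (polycompact_radical act) /\ closed (polycompact_radical act) /\
  (forall K : set M, compact K -> K `<=` polycompact_radical act ->
     exists S : set M, compact_submodule act S /\ K `<=` S).
Proof.
move=> _ cgA [_ lcM] actP.
have compact_sub L := @compact_sub_compact_submodule _ _ _ actP L cgA lcM.
split; [exact: gen_subgroup_is_subgroup|split].
(* A point of the closure forms a compact singleton, so it lies in some compact submodule, hence in
   the radical. *)
- move=> x Wx; have [||S [mS xS]] := compact_sub [set x].
  + exact: compact_set1.
  + by move=> _ ->.
  + by rewrite polycompact_radicalE//; exists S => //; exact: xS.
- move=> K cK KW; apply: compact_sub => //.
  exact: subset_trans KW (@subset_closure _ _).
Qed.
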